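(* For every integer $q\ge 1$, the absolute values of the coefficients of the one-variable Alexander polynomial $\Delta_{\mathrm{Th}(4,q)}(t)$ of $\mathrm{Th}(4,q)$ form a trapezoidal sequence. More precisely, after the substitution $t=-z$ and multiplication by a Laurent unit $\pm z^m$ ($m\in\mathbb Z$), $\Delta_{\mathrm{Th}(4,q)}(t)$ becomes a reciprocal polynomial in $z$ whose coefficient sequence is positive and log-concave.
   Context: $\sigma_1,\sigma_2,\sigma_3$ are the standard generators of the braid group $B_4$, and for $q\ge1$, $\mathrm{Th}(4,q)$ is the four-strand Turk's head knot or link, i.e. the closure $\widehat{(\sigma_1\sigma_2^{-1}\sigma_3)^q}$ of the braid $(\sigma_1\sigma_2^{-1}\sigma_3)^q\in B_4$, with the orientation coming from the braid. The one-variable Alexander polynomial of an oriented link is well defined up to multiplication by a Laurent unit $\pm t^m$; write $f\doteq g$ for equality up to such a unit. For the closure $\widehat\gamma$ of a braid $\gamma\in B_4$ it is given by $$\Delta_{\widehat\gamma}(t)\doteq\frac{1-t}{1-t^4}\det\bigl(I-\overline B(\gamma)\bigr),$$ where $\overline B$ is the reduced Burau representation of $B_4$, determined by $$\overline B(\sigma_1)=\begin{pmatrix}-t&1&0\\0&1&0\\0&0&1\end{pmatrix},\quad \overline B(\sigma_2)=\begin{pmatrix}1&0&0\\t&-t&1\\0&0&1\end{pmatrix},\quad \overline B(\sigma_3)=\begin{pmatrix}1&0&0\\0&1&0\\0&t&-t\end{pmatrix}.$$ No additional division by $(t-1)$ is made in the link case. A finite sequence $(a_0,\dots,a_d)$ of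 nonnegative reals is log-concave if $a_k^2\ge a_{k-1}a_{k+1}$ for $1\le k\le d-1$. A finite sequence is trapezoidal if it is nondecreasing up to some interval, constant on that interval, and nonincreasing afterwards. A polynomial is reciprocal if its coefficient sequence $(a_0,\dots,a_d)$ is symmetric, $a_k=a_{d-k}$. *)

(* Defs.v *)
From HB Require Import structures.
From mathcomp Require Import all_boot all_order all_algebra.
From mathcomp Require Import ring.

Set Implicit Arguments.
Unset Strict Implicit.
Unset Printing Implicit Defensive.

Import Order.TTheory GRing.Theory Num.Theory.
Local Open Scope ring_scope.

(* Elements of the braid group B_4 are represented by words in the standard
   generators and their inverses: (s, false) is s, (s, true) is s^-1.  Two words denote the same braid iff they are related by
   [braid_eq], the Artin presentation. *)
Inductive gen4 := sigma1 | sigma2 | sigma3.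

Definition braid4 := seq (gen4 * bool).

Inductive braid_eq : braid4 -> braid4 -> Prop :=
| braid_eq_refl u : braid_eq u u
| braid_eq_sym u v : braid_eq u v -> braid_eq v u
| braid_eq_trans u v w : braid_eq u v -> braid_eq v w -> braid_eq u w
| braid_eq_cat u u' v v' :
    braid_eq u u' -> braid_eq v v' -> braid_eq (u ++ v) (u' ++ v')
| braid_eq_inv i b : braid_eq [:: (i, b); (i, ~~ b)] [::]
| braid_eq_comm13 :
    braid_eq [:: (sigma1, false); (sigma3, false)] [:: (sigma3, false); (sigma1, false)]
| braid_eq_braid12 :
    braid_eq [:: (sigma1, false); (sigma2, false); (sigma1, false)]
             [:: (sigma2, false); (sigma1, false); (sigma2, false)]
| braid_eq_braid23 :
    braid_eq [:: (sigma2, false); (sigma3, false); (sigma2, false)]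
             [:: (sigma3, false); (sigma2, false); (sigma3, false)].

(* Th(4,q) is the closure of (sigma_1 sigma_2^-1 sigma_3)^q. *)
Definition Th4 (q : nat) : braid4 :=
  flatten (nseq q [:: (sigma1, false); (sigma2, true); (sigma3, false)]).

Section Burau.
Variables (F : fieldType) (t : F).

Definition mx3 (s : seq (seq F)) : 'M[F]_3 :=
  \matrix_(i, j) nth 0 (nth [::] s i) j.

Definition burau_gen (i : gen4) : 'M[F]_3 :=
  match i with
  | sigma1 => mx3 [:: [:: - t; 1; 0];
                      [:: 0;   1; 0];
                      [:: 0;   0; 1]]
  | sigma2 => mx3 [:: [:: 1; 0;   0];
                      [:: t; - t; 1];
                      [:: 0; 0;   1]]
  | sigma3 => mx3 [:: [:: 1; 0; 0];
                      [:: 0; 1; 0];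
                      [:: 0; t; - t]]
  end.

Definition burau_letter (x : gen4 * bool) : 'M[F]_3 :=
  if x.2 then invmx (burau_gen x.1) else burau_gen x.1.

Definition burau (w : braid4) : 'M[F]_3 :=
  foldr (fun x M => burau_letter x *m M) 1%:M w.

Lemma burau_gen_unit i : t != 0 -> burau_gen i \in unitmx.
Proof.
move=> t0.
pose u := t^-1.
pose B := match i with
  | sigma1 => mx3 [:: [:: - u; u; 0]; [:: 0; 1; 0]; [:: 0; 0; 1]]
  | sigma2 => mx3 [:: [:: 1; 0; 0]; [:: 1; - u; u]; [:: 0; 0; 1]]
  | sigma3 => mx3 [:: [:: 1; 0; 0]; [:: 0; 1; 0]; [:: 0; 1; - u]]
  end.
suff /mulmx1_unit[] : burau_gen i *m B = 1%:M by [].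
apply/matrixP => j k; rewrite /B /u; case: i {B}; rewrite !mxE
  !big_ord_recl big_ord0 !mxE.
all: case: j => [[|[|[|//]]] hj]; case: k => [[|[|[|//]]] hk]; rewrite /=; by field.
Qed.

Lemma burau_cat u v : burau (u ++ v) = burau u *m burau v.
Proof. by elim: u => [|x u IH] /=; rewrite ?mul1mx // IH mulmxA. Qed.

(* For t <> 0 the Burau matrix depends only on the braid, not on the word. *)
Lemma burau_braid_eq u v : t != 0 -> braid_eq u v -> burau u = burau v.
Proof.
move=> t0; elim=> {u v} [//|u v _ ->|u v w _ -> _ ->|u u' v v' _ e _ e'|i b|||] //.
- by rewrite !burau_cat e e'.
- by case: b => /=; rewrite mulmx1 /burau_letter /= ?mulVmx ?mulmxV //
     burau_gen_unit.
all: rewrite /burau /burau_letter /=; apply/matrixP => i j.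
all: rewrite !mulmx1 !mxE !big_ord_recl !big_ord0 !mxE ?big_ord_recl ?big_ord0
  ?mxE.
all: case: i => [[|[|[|//]]] hi]; case: j => [[|[|[|//]]] hj]; rewrite /=; ring.
Qed.

End Burau.

(* The field Q(t), as the fraction field of Z[t]; it contains Z[t, t^-1]. *)
Notation Qt := {fraction {poly int}}.

Definition tvar : Qt := FracField.tofrac ('X : {poly int}).

(* Equality up to a unit +-t^m, m an integer, of Z[t, t^-1]. *)
Definition doteq (f g : Qt) : Prop :=
  exists (b : bool) (m : int), f = (-1) ^+ b * tvar ^ m * g.

Definition burau_alexander (w : braid4) : Qt :=
  (1 - tvar) / (1 - tvar ^+ 4) * \det (1%:M - burau tvar w).

(* The Alexander polynomial of the closure of [w] is the class of
   [burau_alexander w] up to units; [f] is one of its representatives.  Every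
   Laurent polynomial is an ordinary polynomial up to a unit, so it suffices to
   consider f in Z[t].  A factor t^m in f is allowed: it only prepends zeros to
   the coefficient sequence. *)
Definition is_alexander (w : braid4) (f : {poly int}) : Prop :=
  doteq (FracField.tofrac f) (burau_alexander w).

Section Sequences.
Variable R : realDomainType.
Implicit Type a : seq R.

Definition log_concave a : Prop :=
  (forall k, (k < size a)%N -> 0 <= a`_k) /\
  (forall k, (1 <= k)%N -> (k.+1 < size a)%N ->
     a`_k.-1 * a`_k.+1 <= a`_k ^+ 2).

(* nondecreasing on [0, i], constant on [i, j], nonincreasing afterwards *)
Definition trapezoidal a : Prop :=
  exists i j : nat,
    [/\ (i <= j < size a)%N,
        forall k, (k < i)%N -> a`_k <= a`_k.+1,
        forall k, (i <= k <= j)%N -> a`_k = a`_i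
      & forall k, (j <= k)%N -> (k.+1 < size a)%N -> a`_k.+1 <= a`_k].

Definition positive_seq a : Prop :=
  forall k, (k < size a)%N -> 0 < a`_k.

End Sequences.

(* A nonzero polynomial p has coefficient sequence p`_0, ..., p`_d with
   d = (size p).-1. *)
Definition reciprocal (p : {poly int}) : Prop :=
  forall k, (k <= (size p).-1)%N -> p`_k = p`_((size p).-1 - k).

Lemma tvar_neq0 : tvar != 0.
Proof. by rewrite tofrac_eq0 polyX_eq0. Qed.

Lemma burau_alexander_braid_eq u v :
  braid_eq u v -> burau_alexander u = burau_alexander v.
Proof.
by move=> uv; rewrite /burau_alexander (burau_braid_eq tvar_neq0 uv).
Qed.

(* Main.v *)
Require Import Defs.
From mathcomp Require Import all_boot all_order all_algebra.
From mathcomp Require Import ring lra zify.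
From mathcomp Require Import Rstruct reals trigo.

Set Implicit Arguments.
Unset Strict Implicit.
Unset Printing Implicit Defensive.

Import Order.TTheory GRing.Theory Num.Theory.
Local Open Scope ring_scope.

(** Write [z = - t].  The matrix [M] of [sigma1 sigma2^-1 sigma3] has [z] as an
    eigenvalue, and its two other eigenvalues [alpha, alpha^-1] satisfy
    [alpha + alpha^-1 = z + z^-1 + 2].  Hence [det (1 - M^q)] is
    [(1 - z^q) (2 - alpha^q - alpha^-q)], and after removal of
    [(1 - z^4) / (1 + z)] the Alexander polynomial becomes, up to a unit,
    [(1 + z + ... + z^(q-1)) A_q(z)], where [A_q] is the homogenization of
    [(alpha^q + alpha^-q - 2) / (alpha + alpha^-1 - 2)] ([turk] below, with the
    determinant computed in [det_burau_turk_alex]).  The polynomial [A_q]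
    is a product of quadratics ([turk_factor]):
    [A_q(z) = prod_(0 < k < q) (z^2 + (2 - 2 cos (2 pi k / q)) z + 1)].

    Log-concave sequences without internal zeros are closed under convolution
    ([lc_polyM]), so it is enough to split [A_q] into log-concave factors.  A
    quadratic of the product is log-concave once its angle is at least [pi / 3].
    The remaining ones are absorbed by others: with [r = q %/ 3], the product of
    the quadratics of indices [k], [r - k] and [r + k] is log-concave for
    [2 k < r] ([lc_turk_triple]); this is an approximation of the triple angle
    formula, which gives the exact statement when [3] divides [q].  When [r] is
    even the index [r / 2] has no such triple and is paired with [r].  These
    groups are disjoint inside [1 .. (q - 1) / 2], and [k] and [q - k] give the
    same quadratic, so [A_q] is covered ([lc_turk]).  The remaining factor
    [1 + z + ... + z^(q-1)] is log-concave as well.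

    The constant coefficient of the resulting polynomial is [1]; with
    log-concavity this makes all coefficients positive, and it forces
    every representative of the Alexander polynomial in [Z[t]] to be a
    nonnegative power of [t] times its value at [- t], up to sign.  Symmetry
    together with log-concavity gives the trapezoidal shape
    ([trapezoidal_shift]). *)

(** * Log-concave polynomials *)

(** The inequality for all [i <= j], and not only for [j = i.+1], forbids internal
    zeros: without this the class would not be closed under products. *)
Definition lc_poly (R : realDomainType) (p : {poly R}) : Prop :=
  (forall i, 0 <= p`_i) /\
  (forall i j, (i <= j)%N -> p`_i * p`_j.+1 <= p`_i.+1 * p`_j).

Lemma lc_poly_spread (R : realDomainType) (p : {poly R}) d x w :
  lc_poly p -> (x <= w)%N -> p`_x * p`_(w + d) <= p`_(x + d) * p`_w.
Proof.
move=> [p0 plc]; elim: d x => [|d IH] x; first by rewrite !addn0.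
rewrite leq_eqVlt => /predU1P[->|xw]; first by rewrite mulrC.
rewrite addnS -addSnnS; apply: le_trans (IH _ xw).
by apply: plc; lia.
Qed.

(** Entry [(n, k)] of the Toeplitz matrix of the coefficients; [lc_poly] says that
    its minors of size 2 are nonnegative. *)
Definition toeplitz (R : realDomainType) (p : {poly R}) (n k : nat) : R :=
  if (k <= n)%N then p`_(n - k) else 0.

Lemma toeplitz_minor (R : realDomainType) (p : {poly R}) m n k l :
  lc_poly p -> (m <= n)%N -> (k <= l)%N ->
  toeplitz p m l * toeplitz p n k <= toeplitz p m k * toeplitz p n l.
Proof.
move=> plc mn kl; have [p0 _] := plc.
have t0 a b : 0 <= toeplitz p a b by rewrite /toeplitz; case: ifP.
have [lm|ml] := leqP l m; last first.
  by rewrite {1}/toeplitz leqNgt ml mul0r mulr_ge0.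
rewrite /toeplitz lm !ifT; try lia.
have /= := @lc_poly_spread _ p (l - k) (m - l) (n - l) plc (leq_sub2r l mn).
have -> : (n - l + (l - k) = n - k)%N by lia.
by have -> : (m - l + (l - k) = m - k)%N by lia.
Qed.

Lemma coefM_toeplitz (R : realDomainType) (p q : {poly R}) n N :
  (n < N)%N -> (p * q)`_n = \sum_(k < N) toeplitz p n k * q`_k.
Proof.
move=> nN; rewrite coefMr (big_ord_widen N (fun k => p`_(n - k) * q`_k)) //.
rewrite big_mkcond; apply: eq_bigr => k _; rewrite /toeplitz ltnS.
by case: ifP; rewrite ?mul0r.
Qed.

(** Cauchy-Binet for minors of size 2: the Toeplitz matrix of a product is the
    product of the Toeplitz matrices, so its minors are sums of products of
    nonnegative minors. *)
Lemma lc_polyM (R : realDomainType) (p q : {poly R}) :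
  lc_poly p -> lc_poly q -> lc_poly (p * q).
Proof.
move=> plc qlc; have [p0 _] := plc; have [q0 qlc'] := qlc.
split=> [i|i j ij].
  by rewrite coefM sumr_ge0 // => k _; rewrite mulr_ge0.
pose N := j.+2; pose A := toeplitz p.
pose q' := q * 'X.
(* [q'] is the next column of the Toeplitz matrix of [q] *)
have shift n : (p * q)`_n = (p * q')`_n.+1 by rewrite mulrA coefMX.
rewrite (shift i) (shift j) !(@coefM_toeplitz _ p _ _ N); try (rewrite /N; lia).
rewrite -subr_ge0 !mulr_suml.
under eq_bigr do rewrite mulr_sumr.
under [X in _ - X]eq_bigr do rewrite mulr_sumr.
rewrite -sumrB; under eq_bigr do rewrite -sumrB.
(* twice the sum, so that the terms at (k, l) and (l, k) combine into a product
   of two minors *)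
set S := \sum_i _; suff : 0 <= S *+ 2 by rewrite pmulrn_lge0.
rewrite mulr2n {2}/S exchange_big /= -big_split /=.
apply: sumr_ge0 => k _; rewrite -big_split /=; apply: sumr_ge0 => l _.
set x := (X in 0 <= X); have -> : x =
  (A i.+1 k * A j.+1 l - A i.+1 l * A j.+1 k) * (q`_k * q'`_l - q'`_k * q`_l).
  by rewrite /x /A; ring.
have q'P a b : (a <= b)%N -> q'`_a * q`_b <= q`_a * q'`_b.
  rewrite /q' !coefMX; case: a b => [|a] [|b] //= ab;
    rewrite ?mul0r ?mulr0 ?mulr_ge0 //.
  exact: qlc'.
have [kl|/ltnW lk] := leqP k l.
  by apply: mulr_ge0; rewrite subr_ge0 ?q'P // toeplitz_minor //; lia.
rewrite -mulrNN; apply: mulr_ge0; rewrite opprB subr_ge0.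
  by rewrite toeplitz_minor //; lia.
by rewrite [leLHS]mulrC [leRHS]mulrC q'P.
Qed.

Lemma lc_poly1 (R : realDomainType) : lc_poly (1 : {poly R}).
Proof.
split=> [i|i j ij]; rewrite !coef1; first by case: (i == _).
by rewrite mulr0 mul0r.
Qed.

Lemma lc_poly_prod (R : realDomainType) (I : Type) (r : seq I) (P : pred I)
    (F : I -> {poly R}) :
  (forall i, P i -> lc_poly (F i)) -> lc_poly (\prod_(i <- r | P i) F i).
Proof.
move=> FP; elim/big_ind: _ => //; [exact: lc_poly1|exact: lc_polyM].
Qed.

(** For positive coefficients the inequalities for neighbours suffice: the ratios
    of consecutive coefficients are nonincreasing. *)
Lemma lc_Poly (R : realDomainType) (s : seq R) :
  all (fun c => 0 < c) s ->
  (forall k, (k.+2 < size s)%N -> s`_k * s`_k.+2 <= s`_k.+1 ^+ 2) ->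
  lc_poly (Poly s).
Proof.
move=> s0 slc.
have sP k : 0 <= s`_k.
  have [ks|ks] := ltnP k (size s); last by rewrite nth_default.
  by apply/ltW/(allP s0)/mem_nth.
split=> [i|i j]; rewrite !coef_Poly //.
move=> ij; rewrite -(subnKC ij); elim: (j - i)%N => [|d IH].
  by rewrite addn0 mulrC.
rewrite addnS; set k := (i + d)%N in IH *.
have [ks|ks] := ltnP k.+2 (size s); last first.
  by rewrite (nth_default _ ks) mulr0 mulr_ge0.
have k0 n : (n <= k.+2)%N -> 0 < s`_n.
  by move=> nk; apply/(allP s0)/mem_nth; apply: leq_ltn_trans ks.
rewrite -(ler_pM2r (mulr_gt0 (k0 k (leqW (leqnSn k))) (k0 k.+1 (leqnSn k.+1)))).
have -> : s`_i * s`_k.+2 * (s`_k * s`_k.+1) =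
  s`_i * s`_k.+1 * (s`_k * s`_k.+2) by ring.
have -> : s`_i.+1 * s`_k.+1 * (s`_k * s`_k.+1) =
  s`_i.+1 * s`_k * s`_k.+1 ^+ 2 by ring.
by apply: ler_pM; rewrite ?mulr_ge0 ?slc.
Qed.

(** * Log-concave groups of quadratics *)

Definition qfac (R : realDomainType) (a : R) : {poly R} :=
  'X^2 + (2 - a)%:P * 'X + 1.

Lemma lc_qfac (R : realDomainType) (a : R) : a <= 1 -> lc_poly (qfac a).
Proof.
move=> a1; have -> : qfac a = Poly [:: 1; 2 - a; 1].
  by rewrite /qfac /= !cons_poly_def; ring.
apply: lc_Poly => /=; first by rewrite ltr01 andbT /=; lra.
by case=> [|k] //= _; nra.
Qed.

(** Here [a = 2 cos phi] and [- b = 2 cos (2 phi)], for [phi] between [pi / 4] and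
    [pi / 3]. *)
Lemma lc_qfac_pair (R : realDomainType) (a b : R) :
  1 <= a -> a ^+ 2 = 2 - b -> 0 <= b <= 1 -> lc_poly (qfac a * qfac (- b)).
Proof.
move=> a1 a2 b01.
have -> : qfac a * qfac (- b) = Poly [:: 1; 4 - a + b; 2 + (2 - a) * (2 + b);
    4 - a + b; 1].
  by rewrite /qfac /= !cons_poly_def !(polyCD, polyCM, polyCN, polyCB); ring.
have a3 : a <= 2 by nra.
apply: lc_Poly => /=.
  by rewrite ltr01 andbT /=; apply/and3P; split; nra.
have h : 4 - a + b <= 2 + (2 - a) * (2 + b) by nra.
have h2 : 2 + (2 - a) * (2 + b) <= (4 - a + b) ^+ 2 by nra.
case=> [|[|[|k]]] //= _; rewrite ?mul1r ?mulr1 //.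
by rewrite -expr2 ler_sqr ?nnegrE //; nra.
Qed.

(** Here [a = 2 cos phi] and [- b = 2 cos rho], while [x] and [y] are
    [2 cos (rho - phi)] and [2 cos (rho + phi)]; the hypotheses on [x + y] and
    [x * y] are the addition formulas.  At [a = 2], [b = 1] the product is
    [(z^2 + 1) (z^2 + 3 z + 1)^2], whose three middle coefficients agree, so the
    bound [b <= 1], that is [rho <= 2 pi / 3], cannot be relaxed. *)
Lemma lc_qfac_triple (R : realDomainType) (a b x y : R) :
  1 <= a <= 2 -> 0 <= b <= 1 -> x + y = - (a * b) ->
  x * y = a ^+ 2 + b ^+ 2 - 4 ->
  lc_poly (qfac a * qfac x * qfac y).
Proof.
move=> /andP[a1 a2] /andP[b0 b1] xy1 xy2.
pose e1 := 6 - a + a * b.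
pose f2 := 3 + ((2 - a) * (4 + a * b) + (a + b) ^+ 2).
pose f3 := 2 * e1 + (2 - a) * (a + b) ^+ 2.
have -> : qfac a * qfac x * qfac y = Poly [:: 1; e1; f2; f3; f2; e1; 1].
  have E u v w : qfac u * qfac v * qfac w = let c := 6 - u - (v + w) in
     let d := 3 + ((2 - u) * (4 - (v + w)) + (4 - 2 * (v + w) + v * w)) in
     Poly [:: 1; c; d; 2 * c + (2 - u) * (4 - 2 * (v + w) + v * w); d; c; 1].
    by rewrite /qfac /= !cons_poly_def !(polyCD, polyCM, polyCN, polyCB); ring.
  rewrite E xy1 xy2 /f3 /e1 /f2 /=; do ?[f_equal]; ring.
have ab : 0 <= a * b <= 2 by nra.
have e1P : 4 <= e1 by rewrite /e1; lra.
have f2P : 0 < f2 by rewrite /f2; nra.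
have f23 : f2 <= f3.
  rewrite -subr_ge0.
  (* the difference is concave in [b]: the weights [1 - b] and [b] carry its
     values at [b = 0] and [b = 1] *)
  have -> : f3 - f2 = (1 - b) * (1 + a * (2 - a) * (1 + a))
     + b * ((2 - a) * (1 + a) ^+ 2) + b * (1 - b) * (a - 1).
    by rewrite /f3 /f2 /e1; ring.
  by rewrite !addr_ge0 ?mulr_ge0 ?exprn_ge0 //; nra.
have f12 : f2 <= e1 ^+ 2 by rewrite /f2 /e1; nra.
have f13 : e1 * f3 <= f2 ^+ 2.
  rewrite -subr_ge0; pose u := 2 - a.
  (* expanded in powers of [b], each coefficient is nonnegative for
     [0 <= u <= 1] *)
  have -> : f2 ^+ 2 - e1 * f3 = (17 - 32 * u + 24 * u ^+ 2)
      + b * (24 - 16 * u + 14 * u ^+ 2 - 4 * u ^+ 3 - u ^+ 4)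
      + b ^+ 2 * (22 - 4 * u - u ^+ 2 - 2 * u ^+ 3 + u ^+ 4)
      + b ^+ 3 * (8 - 2 * u - u ^+ 2) + b ^+ 4.
    by rewrite /f3 /f2 /e1 /u; ring.
  have u0 : 0 <= u by rewrite /u; lra.
  have u1 : u <= 1 by rewrite /u; lra.
  have un n : 0 <= u ^+ n <= 1 by rewrite exprn_ge0 ?exprn_ile1.
  move: (un 2%N) (un 3%N) (un 4%N) => /andP[? ?] /andP[? ?] /andP[? ?].
  have : 0 <= 9 * u ^+ 2 - 12 * u + 4.
    by rewrite (_ : _ + 4 = (3 * u - 2) ^+ 2) ?sqr_ge0 //; ring.
  move=> ?; apply: addr_ge0; last by rewrite exprn_ge0.
  do 2![apply: addr_ge0; last by rewrite mulr_ge0 ?exprn_ge0 //; lra].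
  by rewrite addr_ge0 ?mulr_ge0 //; lra.
apply: lc_Poly => /=.
  by rewrite ltr01 f2P !andbT /=; apply/and3P; split; lra.
have f33 : f2 ^+ 2 <= f3 ^+ 2 by rewrite ler_sqr ?nnegrE //; lra.
case=> [|[|[|[|[|k]]]]] //= _; rewrite ?mul1r ?mulr1 //.
by rewrite mulrC.
Qed.

(** * The polynomials [turk] and their Chebyshev factorization *)

(** With [alpha + alpha^-1 = z + z^-1 + 2], this is
    [z^(n-1) (alpha^n + alpha^-n - 2) / (alpha + alpha^-1 - 2)].  It takes its
    argument in any ring, so that the polynomial is [turk 'X n] and all its
    values come from [turk_morph]. *)
Fixpoint turk (R : comNzRingType) (z : R) (n : nat) : R :=
  if n is m.+1 then
    if m is l.+1 then (1 + z) ^+ 2 * turk z m - z ^+ 2 * turk z l + 2 * z ^+ m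
    else 1
  else 0.

(** If [u = beta + beta^-1], this is
    [(beta^n - beta^-n) / (beta - beta^-1)]: a Chebyshev polynomial of the second
    kind in [u / 2]. *)
Fixpoint chebU (R : comNzRingType) (u : R) (n : nat) : R :=
  if n is m.+1 then
    if m is l.+1 then u * chebU u m - chebU u l else 1
  else 0.

Lemma turkS (R : comNzRingType) (z : R) n :
  turk z n.+2 = (1 + z) ^+ 2 * turk z n.+1 - z ^+ 2 * turk z n + 2 * z ^+ n.+1.
Proof. by []. Qed.

Lemma chebUS (R : comNzRingType) (u : R) n :
  chebU u n.+2 = u * chebU u n.+1 - chebU u n.
Proof. by []. Qed.

Lemma nat_ind2 (P : nat -> Prop) :
  P 0%N -> P 1%N -> (forall n, P n -> P n.+1 -> P n.+2) -> forall n, P n.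
Proof.
move=> P0 P1 PS n; suff: P n /\ P n.+1 by case.
by elim: n => [|n [? ?]]; split=> //; apply: PS.
Qed.

Lemma turk_morph (R S : comNzRingType) (f : {rmorphism R -> S}) (z : R) n :
  f (turk z n) = turk (f z) n.
Proof.
elim/nat_ind2: n => [||n IH IH1]; rewrite ?rmorph0 ?rmorph1 //.
by rewrite !turkS -IH -IH1 rmorphD rmorphB !rmorphM !rmorphXn !rmorphD !rmorph1.
Qed.

Lemma chebU_morph (R S : comNzRingType) (f : {rmorphism R -> S}) (u : R) n :
  f (chebU u n) = chebU (f u) n.
Proof.
elim/nat_ind2: n => [||n IH IH1]; rewrite ?rmorph0 ?rmorph1 //.
by rewrite !chebUS -IH -IH1 !(rmorphB, rmorphM).
Qed.

Lemma chebU_cassini (R : comNzRingType) (u : R) n :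
  chebU u n.+1 ^+ 2 - u * chebU u n.+1 * chebU u n + chebU u n ^+ 2 = 1.
Proof.
elim: n => [|n IH]; first by rewrite /=; ring.
by rewrite -[RHS]IH chebUS; ring.
Qed.

(** With [beta^2 = alpha], the quotient defining [turk] is the square of
    [(beta^n - beta^-n) / (beta - beta^-1)].  Passing to [chebU] matters for the
    factorization, because the roots of [chebU] are simple. *)
Lemma turk_chebU (R : comNzRingType) (z u : R) n :
  z * u ^+ 2 = 1 + 4 * z + z ^+ 2 -> z * turk z n = z ^+ n * chebU u n ^+ 2.
Proof.
move=> zu; elim/nat_ind2: n => [||n IH IH1]; try by rewrite /=; ring.
rewrite turkS.
have -> : z * ((1 + z) ^+ 2 * turk z n.+1 - z ^+ 2 * turk z n + 2 * z ^+ n.+1)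
  = (z * u ^+ 2 - 2 * z) * (z * turk z n.+1)
    - z ^+ 2 * (z * turk z n) + 2 * z ^+ n.+2
      * (chebU u n.+1 ^+ 2 - u * chebU u n.+1 * chebU u n + chebU u n ^+ 2).
  by rewrite chebU_cassini zu !exprS; ring.
by rewrite IH IH1 chebUS !exprS; ring.
Qed.

Lemma size_chebU (R : comNzRingType) n :
  size (chebU ('X : {poly R}) n.+1) = n.+1 /\
  lead_coef (chebU ('X : {poly R}) n.+1) = 1.
Proof.
suff : chebU ('X : {poly R}) n.+1 \is monic /\
       size (chebU ('X : {poly R}) n.+1) = n.+1.
  by move=> [/monicP].
elim/nat_ind2: n => [||n [mn sn] [mn1 sn1]].
- by rewrite /= monic1 size_poly1.
- by rewrite /= mulr1 subr0 monicX size_polyX.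
have sM : size ('X * chebU ('X : {poly R}) n.+2) = n.+3.
  by rewrite mulrC size_mulX ?sn1 // monic_neq0.
have lt : (size (- chebU ('X : {poly R}) n.+1)
            < size ('X * chebU ('X : {poly R}) n.+2)%R)%N.
  by rewrite size_polyN sn sM.
rewrite chebUS; split; last by rewrite size_polyDl // sM.
by rewrite monicE lead_coefDl // mulrC lead_coefMX -monicE.
Qed.

Arguments chebU : simpl never.
Arguments turk : simpl never.

Section TrigonometricFactorization.
Variable R : realType.
Implicit Types (n q k r : nat) (x : R).

Lemma sin_chebU x n : sin x * chebU (2 * cos x) n = sin (n%:R * x).
Proof.
elim/nat_ind2: n => [||n IH IH1].
- by rewrite mulr0 mul0r sin0.
- by rewrite mulr1 mul1r.
have -> : n.+2%:R * x = n.+1%:R * x + x by rewrite -[n.+2]addn1 natrD; ring.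
have E : sin (n%:R * x) = sin (n.+1%:R * x - x).
  by congr sin; rewrite -[n.+1]addn1 natrD; ring.
rewrite chebUS mulrBr IH E mulrCA IH1 sinB sinD; ring.
Qed.

(** The angle is [2 pi k / q]. *)
Definition two_cos q k : R := 2 * cos ((k.*2)%:R * pi / q%:R).

Lemma sin_natpi k : sin (k%:R * pi) = 0 :> R.
Proof.
elim: k => [|k IH]; first by rewrite mul0r sin0.
by rewrite -addn1 natrD mulrDl mul1r sinDpi IH oppr0.
Qed.

Lemma chebU_factor n : (0 < n)%N ->
  chebU 'X n = \prod_(1 <= k < n) ('X - (2 * cos (k%:R * pi / n%:R))%:P) :> {poly R}.
Proof.
case: n => // n _; have [sn ln] := size_chebU R n.
pose rs := [seq 2 * cos (k%:R * pi / n.+1%:R : R) | k <- index_iota 1 n.+1].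
have n0 : n.+1%:R != 0 :> R by rewrite pnatr_eq0.
have ang k : (1 <= k < n.+1)%N -> 0 < (k%:R * pi / n.+1%:R : R) < pi.
  move=> /andP[k1 kn]; rewrite divr_gt0 ?mulr_gt0 ?pi_gt0 ?ltr0n //=.
  by rewrite ltr_pdivrMr ?ltr0n // mulrC ltr_pM2l ?pi_gt0 // ltr_nat.
rewrite (@all_roots_prod_XsubC _ (chebU (_ : {poly R}) n.+1) rs).
- by rewrite ln scale1r big_map.
- by rewrite size_map size_iota sn subn1.
- apply/allP => x /mapP[k]; rewrite mem_index_iota => kn ->.
  rewrite rootE -horner_evalE chebU_morph /= horner_evalE hornerX.
  have s0 : sin (k%:R * pi / n.+1%:R) != 0 :> R.
    by have /andP[k0 kpi] := ang k kn; rewrite gt_eqF // sin_gt0_pi ?k0.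
  apply/eqP/(mulfI s0); rewrite sin_chebU mulr0.
  by rewrite mulrC divfK // sin_natpi.
rewrite uniq_rootsE map_inj_in_uniq ?iota_uniq // => k l.
rewrite !mem_index_iota => /ang kP /ang lP /(mulfI _) E.
apply/eqP; rewrite -(eqr_nat R); apply/eqP.
apply: (mulIf (lt0r_neq0 (pi_gt0 R))).
apply: (mulIf (x := n.+1%:R^-1)); first by rewrite invr_eq0.
apply: cos_inj; last by apply: E; rewrite pnatr_eq0.
  by rewrite in_itv /= !ltW //; case/andP: kP.
by rewrite in_itv /= !ltW //; case/andP: lP.
Qed.

(** The factors of indices [k] and [n - k] of [chebU] are conjugate:
    [(u - 2 cos x) (u + 2 cos x) = u^2 - 2 - 2 cos (2 x)]. *)
Lemma chebU_sqr_factor (u : R) n : (0 < n)%N ->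
  chebU u n ^+ 2 = \prod_(1 <= k < n) (u ^+ 2 - 2 - two_cos n k).
Proof.
move=> n0.
have E : chebU u n = \prod_(1 <= k < n) (u - 2 * cos (k%:R * pi / n%:R)).
  have := congr1 (horner_eval u) (chebU_factor n0).
  rewrite chebU_morph /= !horner_evalE hornerX horner_prod => ->.
  by apply: eq_bigr => k _; rewrite !hornerE.
rewrite expr2 {1}E big_nat_rev /= E -big_split /= !big_nat.
apply: eq_bigr => k /andP[k1 kn].
have nn : n%:R != 0 :> R by rewrite pnatr_eq0 -lt0n.
have -> : (1 + n - k.+1)%:R * pi / n%:R = pi - k%:R * pi / n%:R :> R.
  by rewrite subSS natrB ?(ltnW kn) //; field.
rewrite cosB cospi sinpi mul0r addr0 /two_cos -muln2 natrM.
have -> : k%:R * 2 * pi / n%:R = (k%:R * pi / n%:R) *+ 2 :> R.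
  by field.
by rewrite cos_mulr2n; ring.
Qed.

Lemma poly_eq_pos (p q : {poly R}) :
  (forall x, 0 < x -> p.[x] = q.[x]) -> p = q.
Proof.
move=> pq; apply/eqP; rewrite -subr_eq0; apply/negPn/negP => d0.
pose rs := [seq k.+1%:R : R | k <- iota 0 (size (p - q))].
suff : (size rs < size (p - q)%R)%N by rewrite size_map size_iota ltnn.
apply: max_poly_roots => //.
  by apply/allP => _ /mapP[k _ ->]; rewrite rootE !hornerE pq ?subrr ?ltr0n.
by rewrite map_inj_uniq ?iota_uniq // => k l /eqP; rewrite eqr_nat => /eqP[].
Qed.

Lemma turk_factor n : (0 < n)%N ->
  turk ('X : {poly R}) n = \prod_(1 <= k < n) qfac (two_cos n k).
Proof.
move=> n0; apply: poly_eq_pos => z z0.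
rewrite -horner_evalE turk_morph /= horner_evalE hornerX.
(* for [z > 0] a real [u] with [u^2 = z + z^-1 + 4] exists, and these [z] are
   enough to identify the polynomials *)
pose u := Num.sqrt ((1 + 4 * z + z ^+ 2) / z).
have zu : z * u ^+ 2 = 1 + 4 * z + z ^+ 2.
  rewrite sqr_sqrtr ?divr_ge0 ?addr_ge0 ?mulr_ge0 ?exprn_ge0 ?(ltW z0) //.
  by field; rewrite gt_eqF.
apply: (mulfI (lt0r_neq0 z0)); rewrite (turk_chebU _ zu) chebU_sqr_factor //.
rewrite -[in z ^+ n](prednK n0) exprS -mulrA; congr (_ * _).
have -> : z ^+ n.-1 = \prod_(1 <= k < n) z by rewrite prodr_const_nat subn1.
rewrite -big_split horner_prod; apply: eq_bigr => k _ /=.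
have -> // : (qfac (two_cos n k)).[z] = z * (u ^+ 2 - 2 - two_cos n k).
have -> : z * (u ^+ 2 - 2 - two_cos n k) = z * u ^+ 2 - 2 * z - two_cos n k * z by ring.
by rewrite zu /qfac !hornerE; ring.
Qed.

Lemma two_cos_sym n k : (0 < n)%N -> (k <= n)%N -> two_cos n (n - k) = two_cos n k.
Proof.
move=> n0 kn; have nn : n%:R != 0 :> R by rewrite pnatr_eq0 -lt0n.
rewrite /two_cos -!muln2 !natrM natrB //.
have -> : (n%:R - k%:R) * 2 * pi / n%:R = pi *+ 2 - k%:R * 2 * pi / n%:R :> R.
  by field.
by rewrite cosB cos2pi sin2pi mul0r mul1r addr0.
Qed.

Lemma two_cos_le2 n k : two_cos n k <= 2.
Proof. by have := cos_le1 (k.*2%:R * pi / n%:R : R); rewrite /two_cos; lra. Qed.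

(** [cos (pi / 3)] is a positive root of [4 c^3 - 3 c + 1 = (c + 1) (2 c - 1)^2]. *)
Lemma cos_pi3 : cos (pi / 3) = 1 / 2 :> R.
Proof.
set x : R := pi / 3; have := cospi R.
have -> : pi = x *+ 2 + x :> R by rewrite /x; field.
rewrite cosD cos_mulr2n sin_mulr2n => E.
have {E} : (cos x + 1) * (2 * cos x - 1) ^+ 2 = 0.
  have := sin2cos2 x; move: E; move: (cos x) (sin x) => c s E sE.
  have {}E : (c ^+ 2 *+ 2 - 1) * c - 2 * c * s ^+ 2 = -1 by lra.
  by move: E; rewrite sE => E; lra.
have c0 : 0 < cos x.
  apply: cos_gt0_pihalf; have := pi_gt0 R; rewrite /x; lra.
move/eqP; rewrite mulf_eq0 expf_eq0 /= gt_eqF /=; last lra.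
by move/eqP; lra.
Qed.

(** Comparison of the angles [2 pi k / m] and [2 pi l / n] as fractions; the cosine
    decreases on [[0, pi]]. *)
Lemma two_cos_mono m n k l : (0 < m)%N -> (0 < n)%N -> (l.*2 <= n)%N ->
  (k * n <= l * m)%N -> two_cos n l <= two_cos m k.
Proof.
move=> m0 n0 ln kl.
have mm : 0 < m%:R :> R by rewrite ltr0n.
have nn : 0 < n%:R :> R by rewrite ltr0n.
have p0 := pi_gt0 R.
have h : k.*2%:R * pi / m%:R <= l.*2%:R * pi / n%:R :> R.
  rewrite ler_pdivrMr // mulrAC ler_pdivlMr // mulrAC [leRHS]mulrAC ler_pM2r //.
  by rewrite -!natrM ler_nat -!doubleMl leq_double.
have h2 : l.*2%:R * pi / n%:R <= pi :> R.
  by rewrite ler_pdivrMr // mulrC ler_pM2l // ler_nat.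
rewrite /two_cos ler_pM2l //; move: h; rewrite le_eqVlt => /predU1P[->//|h].
have ge0 i j : 0 <= i%:R * pi / j%:R :> R.
  by rewrite divr_ge0 ?mulr_ge0 ?ler0n // ltW.
by rewrite ltW // ltr_cos // in_itv /= ge0 ?h2 // ltW // (lt_le_trans h h2).
Qed.

Lemma two_cos_sixth : two_cos 6 1 = 1.
Proof.
rewrite /two_cos -muln2 mul1n (_ : _ / _ = pi / 3); last by field.
by rewrite cos_pi3; field.
Qed.

Lemma two_cos_quarter : two_cos 4 1 = 0.
Proof.
rewrite /two_cos -muln2 mul1n (_ : _ / _ = pi / 2); last by field.
by rewrite cos_pihalf mulr0.
Qed.

Lemma two_cos_double n k : two_cos n k.*2 = two_cos n k ^+ 2 - 2.
Proof.
rewrite /two_cos (_ : _ / _ = (k.*2%:R * pi / n%:R) *+ 2).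
  by rewrite cos_mulr2n; ring.
by rewrite -mul2n natrM; ring.
Qed.

Lemma two_cos_third : two_cos 3 1 = - 1.
Proof.
have E : two_cos 3 1 = two_cos 6 2.
  by rewrite /two_cos; congr (2 * cos _); rewrite -!muln2 !natrM; field.
by rewrite E (two_cos_double 6 1) two_cos_sixth; ring.
Qed.

End TrigonometricFactorization.

(** * Log-concavity of the polynomials [turk] *)

Lemma prod_centered (R : comNzRingType) (F : nat -> R) (r s : nat) :
  (s < r)%N -> \prod_(r - s <= k < r + s.+1) F k =
  F r * \prod_(1 <= k < s.+1) (F (r - k)%N * F (r + k)%N).
Proof.
elim: s => [|s IH] sr; first by rewrite subn0 addn1 big_nat1 big_geq ?mulr1.
have E : (r - s.+1).+1 = (r - s)%N by lia.
rewrite big_ltn; last lia.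
rewrite E addnS big_nat_recr /=; last lia.
rewrite (IH (ltnW sr)) [in RHS]big_nat_recr //=; ring.
Qed.

Section LogConcaveTurk.
Variable R : realType.

Lemma two_cos_ge1 q k : (0 < q)%N -> (6 * k <= q)%N -> 1 <= two_cos R q k.
Proof. by move=> q0 kq; rewrite -(two_cos_sixth R) two_cos_mono //; lia. Qed.

Lemma two_cos_le1 q k : (0 < q)%N -> (q <= 6 * k)%N -> (k.*2 <= q)%N -> two_cos R q k <= 1.
Proof. by move=> q0 qk kq; rewrite -(two_cos_sixth R) two_cos_mono //; lia. Qed.

Lemma two_cos_itv q r : (0 < q)%N -> (3 * r <= q <= 4 * r)%N -> 0 <= - two_cos R q r <= 1.
Proof.
move=> q0 /andP[rq qr]; rewrite oppr_ge0 lerNl -(two_cos_quarter R) -(two_cos_third R).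
by rewrite !two_cos_mono //; lia.
Qed.

Lemma lc_turk_triple q r k : (3 * r <= q <= 4 * r)%N -> (2 * k < r)%N ->
  lc_poly (qfac (two_cos R q k) * qfac (two_cos R q (r - k)) * qfac (two_cos R q (r + k))).
Proof.
move=> rq kr; have q0 : (0 < q)%N by lia.
have qq : q%:R != 0 :> R by rewrite pnatr_eq0 -lt0n.
pose x : R := k.*2%:R * pi / q%:R; pose y : R := r.*2%:R * pi / q%:R.
have E1 : two_cos R q (r - k) = 2 * cos (y - x).
  by rewrite /two_cos /y /x doubleB natrB ?leq_double; [congr (2 * cos _); field|lia].
have E2 : two_cos R q (r + k) = 2 * cos (y + x).
  by rewrite /two_cos /y /x doubleD natrD; congr (2 * cos _); field.
apply: (@lc_qfac_triple _ _ (- two_cos R q r)); rewrite ?two_cos_itv //.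
- by rewrite two_cos_le2 two_cos_ge1 //; lia.
- by rewrite E1 E2 cosB cosD /two_cos -/x -/y; ring.
rewrite E1 E2 cosB cosD /two_cos -/x -/y.
have := sin2cos2 x; have := sin2cos2 y.
move: (sin x) (sin y) (cos x) (cos y) => a b c d h1 h2.
have -> : 2 * (d * c + b * a) * (2 * (d * c - b * a)) =
  4 * (d ^+ 2 * c ^+ 2 - b ^+ 2 * a ^+ 2) by ring.
by rewrite h1 h2; ring.
Qed.

(** The range [1 .. (q - 1) / 2] is cut at [s], [r - s] and [r + s], where [s] is
    the largest integer with [2 s < r]: the triples fill the blocks [1 .. s] and
    [r - s .. r + s] except for [r], and what lies between [s] and [r - s] is
    [r / 2] when [r] is even and nothing otherwise. *)
Lemma lc_turk_half q : lc_poly (\prod_(1 <= k < (q.-1)./2.+1) qfac (two_cos R q k)).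
Proof.
have [q3|q3] := ltnP q 3.
  by case: q q3 => [|[|[|]]] //= _; rewrite big_geq //; apply: lc_poly1.
set h := q.-1./2; pose r := (q %/ 3)%N; pose s := (r.-1)./2.
pose F k := qfac (two_cos R q k).
have rs : (r = s.*2.+1 \/ r = s.*2.+2)%N by rewrite /s /r; lia.
have q0 : (0 < q)%N by lia.
have rq : (3 * r <= q)%N by rewrite /r; lia.
have big k : (q <= 6 * k)%N -> (k <= h)%N -> lc_poly (F k).
  by move=> qk kh; apply: lc_qfac; apply: two_cos_le1 => //; lia.
have sr : (s < r)%N by lia.
have rsh : (r + s <= h)%N by lia.
rewrite (big_cat_nat (n := r + s.+1)) //=; [|lia|lia].
apply: lc_polyM; last first.
  rewrite big_nat; apply: lc_poly_prod => k /andP[k1 k2]; apply: big; lia.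
rewrite (big_cat_nat (n := r - s)) /=; [|lia|lia].
rewrite prod_centered // (big_cat_nat (n := s.+1)) /=; [|lia|lia].
set lo := \prod_(1 <= k < s.+1) qfac _; set mid := \prod_(s.+1 <= k < _) _.
set T := \prod_(1 <= k < s.+1) _.
have -> : lo * mid * (F r * T) = (lo * T) * (mid * F r) by ring.
apply: lc_polyM.
  rewrite -big_split big_nat; apply: lc_poly_prod => k /andP[k1 k2].
  by rewrite /= mulrA; apply: lc_turk_triple; lia.
case: rs => rs.
  by rewrite /mid big_geq ?mul1r; [apply: big; lia|lia].
have -> : mid = F s.+1.
  by rewrite /mid (_ : (r - s)%N = s.+2) ?big_nat1 //; lia.
have E : two_cos R q r = two_cos R q s.+1 ^+ 2 - 2 by rewrite -two_cos_double rs.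
rewrite /F -[two_cos R q r]opprK; apply: lc_qfac_pair.
- by apply: two_cos_ge1 => //; lia.
- by rewrite E; ring.
- by apply: two_cos_itv => //; lia.
Qed.

Lemma lc_turk q : (0 < q)%N -> lc_poly (turk ('X : {poly R}) q).
Proof.
move=> q0; rewrite turk_factor //; set h := q.-1./2.
rewrite (big_cat_nat (n := h.+1)) //=; last lia.
apply: lc_polyM; first exact: lc_turk_half.
have -> : \prod_(h.+1 <= k < q) qfac (two_cos R q k) =
  \prod_(h.+1 <= k < q - h) qfac (two_cos R q k) *
  \prod_(1 <= k < h.+1) qfac (two_cos R q k).
  rewrite (big_cat_nat (n := (q - h)%N)) /=; [|lia|lia]; congr (_ * _).
  rewrite [RHS]big_nat_rev /= (_ : (q - h)%N = (1 + (q - h.+1))%N); last lia.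
  rewrite big_addn (_ : (q - (q - h.+1))%N = h.+1); last lia.
  rewrite !big_nat; apply: eq_bigr => k /andP[k1 k2].
  by rewrite -two_cos_sym; [congr (qfac (two_cos R q _)); lia|lia|lia].
apply: lc_polyM; last exact: lc_turk_half.
rewrite big_nat; apply: lc_poly_prod => k /andP[k1 k2].
by apply: lc_qfac; apply: two_cos_le1; lia.
Qed.
End LogConcaveTurk.

(** * The determinant of the Burau matrix *)

Lemma mx3M (F : fieldType) (a b c d e f g h k a' b' c' d' e' f' g' h' k' : F) :
  mx3 [:: [:: a; b; c]; [:: d; e; f]; [:: g; h; k]] *m
  mx3 [:: [:: a'; b'; c']; [:: d'; e'; f']; [:: g'; h'; k']] =
  mx3 [:: [:: a * a' + b * d' + c * g'; a * b' + b * e' + c * h';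
              a * c' + b * f' + c * k'];
          [:: d * a' + e * d' + f * g'; d * b' + e * e' + f * h';
              d * c' + e * f' + f * k'];
          [:: g * a' + h * d' + k * g'; g * b' + h * e' + k * h';
              g * c' + h * f' + k * k']].
Proof.
apply/matrixP => i j; rewrite !mxE !big_ord_recl big_ord0 !mxE.
by case: i => [[|[|[|//]]] hi]; case: j => [[|[|[|//]]] hj]; rewrite /= addr0 addrA.
Qed.

Lemma mx3_1 (F : fieldType) :
  1%:M = mx3 [:: [:: 1; 0; 0]; [:: 0; 1; 0]; [:: 0; 0; 1 : F]].
Proof.
apply/matrixP => i j; rewrite !mxE.
by case: i => [[|[|[|//]]] hi]; case: j => [[|[|[|//]]] hj].
Qed.

Lemma mx3B (F : fieldType) (a b c d e f g h k a' b' c' d' e' f' g' h' k' : F) :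
  mx3 [:: [:: a; b; c]; [:: d; e; f]; [:: g; h; k]] -
  mx3 [:: [:: a'; b'; c']; [:: d'; e'; f']; [:: g'; h'; k']] =
  mx3 [:: [:: a - a'; b - b'; c - c']; [:: d - d'; e - e'; f - f'];
          [:: g - g'; h - h'; k - k']].
Proof.
apply/matrixP => i j; rewrite !mxE.
by case: i => [[|[|[|//]]] hi]; case: j => [[|[|[|//]]] hj].
Qed.

Lemma det_mx3 (F : fieldType) (a b c d e f g h k : F) :
  \det (mx3 [:: [:: a; b; c]; [:: d; e; f]; [:: g; h; k]]) =
  a * (e * k - f * h) - b * (d * k - f * g) + c * (d * h - e * g).
Proof.
rewrite (expand_det_row _ 0) !big_ord_recl big_ord0 /cofactor !mxE /=.
rewrite !(expand_det_row _ 0) !big_ord_recl !big_ord0 /cofactor !mxE /=.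
rewrite !det_mx11 !mxE /= ?expr0 ?expr1 ?expr2; ring.
Qed.

Section BurauTurk.
Variables (F : fieldType) (t : F).
Hypotheses (t0 : t != 0).
Let z := - t.
Let tau := 2 + z + z^-1.
Let z0 : z != 0. Proof. by rewrite oppr_eq0. Qed.

Definition turk_mx : 'M[F]_3 :=
  mx3 [:: [:: 1 - t; 1 - t^-1; -1]; [:: 1; 1 - t^-1; -1]; [:: 0; t; - t]].

Lemma burau_turk_step :
  burau t [:: (sigma1, false); (sigma2, true); (sigma3, false)] = turk_mx.
Proof.
rewrite /burau /= /burau_letter /= mulmx1.
pose B := mx3 [:: [:: 1; 0; 0]; [:: 1; - t^-1; t^-1]; [:: 0; 0; 1]].
have BK : burau_gen t sigma2 *m B = 1%:M.
  by rewrite /burau_gen mx3M mx3_1;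
    congr (mx3 [:: [:: _; _; _]; [:: _; _; _]; [:: _; _; _]]); field.
have -> : mx3 [:: [:: 1; 0; 0]; [:: t; - t; 1]; [:: 0; 0; 1]]
    = burau_gen t sigma2 by [].
have -> : invmx (burau_gen t sigma2) = B.
  by rewrite -[LHS]mulmx1 -BK mulKmx // burau_gen_unit.
by rewrite !mx3M; congr (mx3 [:: [:: _; _; _]; [:: _; _; _]; [:: _; _; _]]); field.
Qed.

Lemma burau_Th4 q : burau t (Th4 q) = turk_mx ^+ q.
Proof.
elim: q => [//|q IH].
by rewrite exprS -IH -burau_turk_step -[_ * _]/(_ *m _) -burau_cat.
Qed.

(* The columns are the eigenvector [v] for [z], a vector [e] of the plane killed
   by the left eigenvector [(1, -1, 1)] for [z], and the image of [e]. *)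
Let Q : 'M[F]_3 :=
  mx3 [:: [:: 1; 1; tau]; [:: 0; 1; tau - z]; [:: 1; 0; - z]].
(* [D n] is the [n]-th power of [diag(z, C)] for the companion matrix [C] of
   [x^2 - tau x + 1]. *)
Let D n : 'M[F]_3 :=
  mx3 [:: [:: z ^+ n; 0; 0];
          [:: 0; chebU tau n.+1 - tau * chebU tau n; - chebU tau n];
          [:: 0; chebU tau n; chebU tau n.+1]].

Lemma turk_mx_Q n : turk_mx ^+ n *m Q = Q *m D n.
Proof.
have QD : turk_mx *m Q = Q *m D 1.
  rewrite /turk_mx /Q /D chebUS /chebU !mx3M;
    congr (mx3 [:: [:: _; _; _]; [:: _; _; _]; [:: _; _; _]]);
    by rewrite /tau /z; field; rewrite ?oppr_eq0 ?t0.
elim: n => [|n IH].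
  rewrite expr0 -[1]/(1%:M) mul1mx /D /chebU mulr0 subr0 oppr0 expr0 -mx3_1.
  by rewrite mulmx1.
rewrite exprS -[_ * _]/(_ *m _) -mulmxA IH mulmxA QD -mulmxA; congr (_ *m _).
rewrite /D mx3M !chebUS /chebU;
  congr (mx3 [:: [:: _; _; _]; [:: _; _; _]; [:: _; _; _]]);
  by rewrite ?exprS; ring.
Qed.

Hypothesis two0 : 2 != 0 :> F.

Lemma det_burau_Th4 q : \det (1%:M - burau t (Th4 q)) =
  (1 - z ^+ q) * (2 + tau * chebU tau q - 2 * chebU tau q.+1).
Proof.
have Q0 : \det Q != 0.
  rewrite det_mx3 (_ : _ + _ = - (2 * z)); last by ring.
  by rewrite oppr_eq0 mulf_neq0.
apply: (mulIf Q0); rewrite burau_Th4 -det_mulmx mulmxBl mul1mx turk_mx_Q.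
rewrite -{1}[Q]mulmx1 -mulmxBr det_mulmx mulrC; congr (_ * _).
rewrite mx3_1 /D mx3B det_mx3.
have C := chebU_cassini tau q.
move: (chebU tau q) (chebU tau q.+1) C => U V C.
have -> : 2 + tau * U - 2 * V = 1 + tau * U - 2 * V +
   (V ^+ 2 - tau * V * U + U ^+ 2) by rewrite C; ring.
ring.
Qed.

End BurauTurk.

(** Up to a power of [z], both sides are [alpha^n + alpha^-n - 2], since
    [tau = alpha + alpha^-1] and [tau - 2 = (1 + z^2) / z]. *)
Lemma turk_chebU_tau (F : fieldType) (z : F) n : z != 0 ->
  let tau := 2 + z + z^-1 in
  z ^+ n * (2 * chebU tau n.+1 - tau * chebU tau n - 2) = (1 + z ^+ 2) * turk z n.
Proof.
move=> z0 tau; have E : z * tau = (1 + z) ^+ 2 by rewrite /tau; field.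
elim/nat_ind2: n => [||n IH IH1].
- by rewrite /chebU /turk; ring.
- by rewrite chebUS /chebU /turk expr1 /tau; field.
rewrite turkS.
have -> : z ^+ n.+2 * (2 * chebU tau n.+3 - tau * chebU tau n.+2 - 2) =
  (z * tau) * (z ^+ n.+1 * (2 * chebU tau n.+2 - tau * chebU tau n.+1 - 2))
  - z ^+ 2 * (z ^+ n * (2 * chebU tau n.+1 - tau * chebU tau n - 2))
  + z ^+ n.+1 * (2 * (z * tau) - 4 * z).
  by rewrite !chebUS !exprS; ring.
by rewrite IH IH1 E !exprS; ring.
Qed.

(** * The normalized Alexander polynomial *)

(** At [z = - t] this is the Alexander polynomial of [Th(4,q)], normalized so that
    the constant coefficient is [1]. *)
Definition turk_alex (R : comNzRingType) (z : R) (q : nat) : R :=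
  turk z q * \sum_(i < q) z ^+ i.

Lemma turk_alex_morph (R S : comNzRingType) (f : {rmorphism R -> S}) (z : R) q :
  f (turk_alex z q) = turk_alex (f z) q.
Proof.
rewrite rmorphM turk_morph rmorph_sum; congr (_ * _).
by apply: eq_bigr => i _; rewrite rmorphXn.
Qed.

Lemma turk_alex_inv (F : fieldType) (z : F) q : z != 0 -> (0 < q)%N ->
  turk_alex z q = z ^+ (3 * q.-1) * turk_alex z^-1 q.
Proof.
move=> z0; case: q => // q _.
have T n : z ^+ 2 * turk z n = (z ^+ n) ^+ 2 * turk z^-1 n.
  elim/nat_ind2: n => [||n IH IH1].
  - by rewrite /turk; ring.
  - by rewrite /turk expr1; ring.
  rewrite !turkS.
  have -> : z ^+ 2 * ((1 + z) ^+ 2 * turk z n.+1 - z ^+ 2 * turk z n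
     + 2 * z ^+ n.+1) = (1 + z) ^+ 2 * (z ^+ 2 * turk z n.+1)
     - z ^+ 2 * (z ^+ 2 * turk z n) + 2 * z ^+ n.+3 by rewrite !exprS; ring.
  rewrite IH IH1 !exprVn !exprS; field; apply/andP; split; last by [].
  exact: expf_neq0.
have S : \sum_(i < q.+1) z ^+ i = z ^+ q * \sum_(i < q.+1) z^-1 ^+ i.
  rewrite (reindex_inj rev_ord_inj) mulr_sumr; apply: eq_bigr => i _ /=.
  have iq : (i <= q)%N by rewrite -ltnS.
  have -> : z ^+ q = z ^+ (q - i) * z ^+ i by rewrite -exprD subnK.
  by rewrite subSS exprVn mulfK ?expf_neq0.
apply: (mulfI (expf_neq0 2 z0)).
rewrite /turk_alex S mulrA T [(3 * _)%N]mulnC !exprM !exprS /=.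
by ring.
Qed.

Lemma size_turk (R : comNzRingType) n :
  (size (turk ('X : {poly R}) n.+1) <= n.*2.+1)%N.
Proof.
have X1 : (size ((1 + 'X : {poly R}) ^+ 2) <= 3)%N.
  by rewrite expr2 (leq_trans (size_polyMleq _ _)) // addrC -[1]polyC1 size_XaddC.
have M (p p' : {poly R}) k l : (size p <= k.+1)%N -> (size p' <= l)%N ->
    (size (p * p')%R <= k + l)%N.
  move=> pk pl; apply: leq_trans (size_polyMleq _ _) _.
  by rewrite -subn1 leq_subLR add1n -addSn leq_add.
elim/nat_ind2: n => [||n IH IH1].
- by rewrite size_poly1.
- rewrite turkS /turk mulr1 mulr0 subr0 expr1.
  rewrite (leq_trans (size_polyD _ _)) // geq_max X1 mulr_natl -scaler_nat.
  by rewrite (leq_trans (size_scale_leq _ _)) // size_polyX.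
rewrite turkS (leq_trans (size_polyD _ _)) // geq_max; apply/andP; split.
  rewrite (leq_trans (size_polyD _ _)) // geq_max size_polyN; apply/andP; split.
    exact: (@M _ _ 2%N (n.+1.*2.+1)).
  apply: leq_trans (@M _ _ 2%N n.*2.+1 _ IH) _; first by rewrite size_polyXn.
  by rewrite doubleS; lia.
rewrite mulr_natl -scaler_nat (leq_trans (size_scale_leq _ _)) // size_polyXn; lia.
Qed.

Lemma size_turk_alex (R : comNzRingType) q : (0 < q)%N ->
  (size (turk_alex ('X : {poly R}) q) <= (3 * q.-1).+1)%N.
Proof.
case: q => // q _; rewrite /turk_alex.
apply: leq_trans (size_polyMleq _ _) _.
have S : (size (\sum_(i < q.+1) ('X^i : {poly R}))%R <= q.+1)%N.
  by apply: (leq_trans (size_sum _ _ _)); apply/bigmax_leqP => i _;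
    rewrite size_polyXn.
rewrite -subn1 leq_subLR add1n; apply: leq_trans (leq_add (size_turk R q) S) _.
by rewrite /=; lia.
Qed.

(** [turk_alex_inv] equates the values of the polynomial and of its reversal. *)
Lemma turk_alex_sym q : (0 < q)%N -> forall i, (i <= 3 * q.-1)%N ->
  (turk_alex ('X : {poly int}) q)`_i = (turk_alex 'X q)`_(3 * q.-1 - i).
Proof.
move=> q0; set d := (3 * q.-1)%N.
pose R := Rdefinitions.R : realType.
set p : {poly R} := turk_alex 'X q.
have pE : p = \poly_(i < d.+1) p`_(d - i).
  apply: poly_eq_pos => x x0.
  rewrite -[LHS]horner_evalE turk_alex_morph /= horner_evalE hornerX.
  rewrite turk_alex_inv ?gt_eqF // -/d horner_poly.
  have -> : turk_alex x^-1 q = p.[x^-1].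
    by rewrite -[RHS]horner_evalE turk_alex_morph /= horner_evalE hornerX.
  rewrite (horner_coef_wide _ (size_turk_alex R q0)) -/d mulr_sumr.
  rewrite (reindex_inj rev_ord_inj); apply: eq_bigr => i _ /=.
  rewrite subSS mulrCA; congr (_ * _); rewrite exprVn.
  have id : (i <= d)%N by rewrite -ltnS.
  have -> : x ^+ d = x ^+ i * x ^+ (d - i) by rewrite -exprD subnKC.
  by rewrite mulfK // expf_neq0 // gt_eqF.
have mapE : p = map_poly intr (turk_alex ('X : {poly int}) q).
  by rewrite turk_alex_morph /= map_polyX.
move=> i id; apply: (@intr_inj R).
by rewrite -!coef_map -mapE {1}pE coef_poly ltnS id.
Qed.

(** The quadratic factors only exist over the reals, but log-concavity is a
    statement on the coefficients and descends to the integers. *)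
Lemma lc_turk_alex q : (0 < q)%N -> lc_poly (turk_alex ('X : {poly int}) q).
Proof.
move=> q0; pose R := Rdefinitions.R : realType.
have mapE : turk_alex 'X q =
    map_poly (intr : int -> R) (turk_alex ('X : {poly int}) q).
  by rewrite turk_alex_morph /= map_polyX.
have [] : lc_poly (turk_alex ('X : {poly R}) q).
  apply: lc_polyM; first exact: lc_turk.
  have -> : \sum_(i < q) 'X^i = \poly_(i < q) (1 : R).
    by rewrite poly_def; apply: eq_bigr => i _; rewrite scale1r.
  split=> [i|i j ij]; rewrite !coef_poly; first by case: ifP.
  have [jq|] := ltnP j.+1 q; first by rewrite !ifT //; lia.
  by rewrite mulr0; case: ifP; case: ifP; rewrite ?mulr1 ?mulr0.
rewrite mapE => p0 plc; split=> [i|i j ij].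
  by have := p0 i; rewrite coef_map ler0z.
by have := plc i j ij; rewrite !coef_map /= -!intrM ler_int.
Qed.

Lemma turk_alex_coef0 q : (0 < q)%N -> (turk_alex ('X : {poly int}) q)`_0 = 1.
Proof.
case: q => // q _; rewrite -horner_coef0 -horner_evalE turk_alex_morph /=.
rewrite horner_evalE hornerX /turk_alex big_ord_recl expr0 big1 ?addr0 => [|i _].
  rewrite mulr1; case: q => [//|q]; elim: q => [|q IH].
    by rewrite /turk; ring.
  by rewrite turkS IH !exprS; ring.
by rewrite /= exprS mul0r.
Qed.

(** By symmetry the coefficient of index [3 (q - 1)] is the constant one. *)
Lemma size_turk_alexE q : (0 < q)%N ->
  size (turk_alex ('X : {poly int}) q) = (3 * q.-1).+1.
Proof.
move=> q0; apply/eqP; rewrite eqn_leq size_turk_alex // ltnNge.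
apply/negP => /leq_sizeP/(_ _ (leqnn _)) /eqP.
by rewrite -[X in _`_X]subn0 -turk_alex_sym ?turk_alex_coef0.
Qed.

(** No internal zeros: [0 < p`_0 * p`_j.+1 <= p`_1 * p`_j], so positivity goes down
    from the leading coefficient. *)
Lemma lc_poly_gt0 (R : realDomainType) (p : {poly R}) i :
  lc_poly p -> 0 < p`_0 -> (i < size p)%N -> 0 < p`_i.
Proof.
move=> [p0 plc] c0 ip; have sp : (0 < size p)%N by exact: leq_ltn_trans ip.
rewrite -(subKn (_ : i <= (size p).-1)%N); last by rewrite -ltnS prednK.
elim: ((size p).-1 - i)%N => [|k IH].
  by rewrite subn0 lt0r p0 -lead_coefE lead_coef_eq0 -size_poly_gt0 sp.
have [kp|kp] := leqP (size p).-1 k.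
  by rewrite (_ : ((size p).-1 - k.+1)%N = 0%N) //;
    apply/eqP; rewrite subn_eq0 leqW.
set j := ((size p).-1 - k.+1)%N.
have E : ((size p).-1 - k)%N = j.+1 by rewrite /j subnSK.
rewrite E in IH; have H := lt_le_trans (mulr_gt0 c0 IH) (plc 0%N j (leq0n j)).
by rewrite lt0r p0 andbT; apply: contraTneq H => ->; rewrite mulr0 ltxx.
Qed.

(** For [j = d - k - 1] the log-concavity inequality reads
    [p`_k ^+ 2 <= p`_k.+1 ^+ 2]. *)
Lemma lc_poly_sym_rise (R : realDomainType) (p : {poly R}) d k :
  lc_poly p -> (forall i, (i <= d)%N -> p`_i = p`_(d - i)) ->
  (k.*2 < d)%N -> p`_k <= p`_k.+1.
Proof.
move=> [p0 plc] ps kd; rewrite -ler_sqr ?nnegrE // !expr2.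
have /plc : (k <= d - k.+1)%N by lia.
by rewrite -(ps k.+1) 1?(_ : (d - k.+1).+1 = (d - k)%N) -1?(ps k); lia || by [].
Qed.

(** * Representatives up to units *)

Lemma doteq_sym f g : doteq f g -> doteq g f.
Proof.
move=> [b [m ->]]; exists b, (- m); rewrite -invr_expz.
have : tvar ^ m != 0 by rewrite expfz_neq0 ?tvar_neq0.
move: (tvar ^ m) => x x0; have e2 : (-1) ^+ b * (-1) ^+ b = 1 :> Qt.
  by rewrite -expr2 sqrr_sign.
by rewrite -!mulrA [x^-1 * _]mulrCA mulKf // mulrA e2 mul1r.
Qed.

Lemma doteq_trans f g h : doteq f g -> doteq g h -> doteq f h.
Proof.
move=> [b [m ->]] [c [n ->]]; exists (b (+) c), (m + n).
by rewrite signr_addb expfzDr ?tvar_neq0 //; ring.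
Qed.

Lemma det_burau_turk_alex (F : fieldType) (t : F) q :
  t != 0 -> 2 != 0 :> F -> 1 - t ^+ 4 != 0 ->
  (1 - t) / (1 - t ^+ 4) * \det (1%:M - burau t (Th4 q)) =
  (-1) ^+ (~~ odd q) * (t ^+ q)^-1 * turk_alex (- t) q.
Proof.
move=> t0 two0 T4; rewrite (det_burau_Th4 t0 two0).
set z := - t; set tau := 2 + z + z^-1.
have z0 : z != 0 by rewrite oppr_eq0.
have zq : z ^+ q != 0 by rewrite expf_neq0.
have geo : 1 - z ^+ q = (1 - z) * \sum_(i < q) z ^+ i.
  by rewrite -opprB subrX1 -mulNr opprB.
have L : 2 + tau * chebU tau q - 2 * chebU tau q.+1 =
   - ((1 + z ^+ 2) * turk z q / z ^+ q).
  by rewrite -turk_chebU_tau // -/tau; field.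
have -> : (-1) ^+ (~~ odd q) * (t ^+ q)^-1 = - (z ^+ q)^-1.
  rewrite /z [(- t) ^+ q]exprNn -(signr_odd _ q).
  by case: (odd q); rewrite /= ?expr0 ?expr1 ?mul1r ?mulN1r ?invrN ?opprK.
rewrite L geo /turk_alex; have tz : t = - z by rewrite opprK.
move: (\sum_(i < q) _) (turk z q) T4 => S U; rewrite tz => T4.
by field; rewrite zq T4.
Qed.

Lemma burau_alexander_doteq q :
  doteq (burau_alexander (Th4 q))
        (FracField.tofrac (turk_alex 'X q \Po - 'X)).
Proof.
have two0 : 2 != 0 :> Qt.
  rewrite -(rmorph_nat (@FracField.tofrac {poly int})).
  by rewrite tofrac_eq0 -polyC_natr polyC_eq0.
have T4 : 1 - tvar ^+ 4 != 0.
  rewrite /tvar -rmorphXn -(rmorph1 (@FracField.tofrac {poly int})) -rmorphB.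
  by rewrite tofrac_eq0 -opprB oppr_eq0 -size_poly_gt0 size_XnsubC.
exists (~~ odd q), (- q%:Z).
rewrite /burau_alexander (det_burau_turk_alex q tvar_neq0 two0 T4) -invr_expz.
congr (_ * _); apply/esym.
have -> : turk_alex ('X : {poly int}) q \Po - 'X = turk_alex (- 'X) q.
  have := turk_alex_morph (comp_poly (- 'X : {poly int})) 'X q.
  by rewrite /= comp_polyX.
have := turk_alex_morph (@FracField.tofrac {poly int}) (- 'X) q => /= ->.
by rewrite tofracN.
Qed.

Lemma nth_norm (R : numDomainType) (s : seq R) k :
  [seq `|c| | c <- s]`_k = `|s`_k|.
Proof.
have [ks|ks] := ltnP k (size s); first by rewrite (nth_map 0).
by rewrite !nth_default ?size_map ?normr0.
Qed.

Lemma trapezoidal_shift (R : realDomainType) (p : {poly R}) d n (s : seq R) :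
  lc_poly p -> size p = d.+1 ->
  (forall i, (i <= d)%N -> p`_i = p`_(d - i)) ->
  size s = (n + size p)%N ->
  (forall k, s`_k = if (k < n)%N then 0 else p`_(k - n)) -> trapezoidal s.
Proof.
move=> plc sp psym ss sE; have [p0 _] := plc.
have rise k : (k.*2 < d)%N -> p`_k <= p`_k.+1 by exact: lc_poly_sym_rise.
have mid : (d./2.*2 <= d < d./2.*2.+2)%N by lia.
exists (n + d./2)%N, (n + d./2)%N; split.
- by rewrite leqnn ss sp /=; lia.
- move=> k kn; rewrite !sE; case: ifP => [_|/negbT]; last rewrite -leqNgt.
    by case: ifP => _ //; rewrite lexx.
  move=> nk; rewrite ltnNge (leqW nk) /= subSn //; apply: rise; lia.
- by move=> k /andP[h1 h2]; congr (s`_ _); lia.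
move=> k nk; rewrite ss sp => ks.
have kn : (n <= k)%N by lia.
rewrite !sE !ltnNge kn (leqW kn) /= subSn //.
set j := (k - n)%N; rewrite (psym j) ?(psym j.+1) /j; [|lia|lia].
have -> : (d - (k - n) = (d - (k - n).+1).+1)%N by lia.
apply: rise; lia.
Qed.

(** The exponent is nonnegative because [g] has a nonzero constant coefficient. *)
Lemma tofrac_unitM_poly (b : bool) m (f g : {poly int}) :
  FracField.tofrac f = (-1) ^+ b * tvar ^ m * FracField.tofrac g -> g`_0 != 0 ->
  exists n : nat, f = (-1) ^+ b * 'X^n * g.
Proof.
move=> fg g0; case: m fg => k fg.
  exists k; apply/eqP; rewrite -tofrac_eq fg.
  by rewrite !tofracM !tofracXn tofracN tofrac1.
have T0 : tvar ^+ k.+1 != 0 by rewrite expf_neq0 // tvar_neq0.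
exfalso; move/eqP: g0; apply.
have : FracField.tofrac ('X^(k.+1) * f) == FracField.tofrac ((-1) ^+ b * g).
  rewrite !tofracM fg NegzE -invr_expz !tofracXn tofracN tofrac1.
  by rewrite -/tvar -exprnP !mulrA [_ ^+ k.+1 * _]mulrC mulfK.
rewrite tofrac_eq => /eqP /(congr1 (fun p : {poly int} => p`_0)).
rewrite coefXnM /= -signr_odd; case: (odd b) => /=.
  by rewrite expr1 mulN1r coefN => /eqP; rewrite eq_sym oppr_eq0 => /eqP.
by rewrite mul1r.
Qed.

Lemma coef_comp_polyNX (R : comNzRingType) (p : {poly R}) k :
  (p \Po - 'X)`_k = (-1) ^+ k * p`_k.
Proof.
have -> : p \Po - 'X = \poly_(i < size p) ((-1) ^+ i * p`_i).
  rewrite comp_polyE poly_def; apply: eq_bigr => i _.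
  rewrite [(- 'X) ^+ i]exprNn -!mul_polyC polyCM polyC_exp polyCN polyC1; ring.
by rewrite coef_poly; case: ltnP => // kp; rewrite nth_default // mulr0.
Qed.

Lemma comp_polyNX_shift (R : comNzRingType) (b : bool) n (p : {poly R}) :
  ((-1) ^+ b * 'X^n * (p \Po - 'X)) \Po - 'X = (-1) ^+ (b (+) odd n) * 'X^n * p.
Proof.
rewrite !comp_polyM -comp_polyA [- 'X \Po _]rmorphN /= comp_polyX opprK.
rewrite comp_polyXr comp_Xn_poly [(- 'X) ^+ n]exprNn -(signr_odd _ n) mulrA.
rewrite signr_addb; congr (_ * _ * _ * _).
by case: b; rewrite ?expr0 ?expr1 ?rmorphN rmorph1.
Qed.

Theorem theorem1p1 (q : nat) (hq : (1 <= q)%N) :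
  (exists f : {poly int}, is_alexander (Th4 q) f) /\
  (forall f : {poly int}, is_alexander (Th4 q) f ->
     trapezoidal [seq `|c| | c <- polyseq f] /\
     (exists g : {poly int},
        [/\ doteq (FracField.tofrac g) (FracField.tofrac (f \Po - 'X)),
            g != 0,
            reciprocal g,
            positive_seq (polyseq g)
          & log_concave (polyseq g)])).
Proof.
pose g := turk_alex ('X : {poly int}) q.
have glc : lc_poly g := lc_turk_alex hq.
have g0 : g`_0 = 1 := turk_alex_coef0 hq.
have gs := size_turk_alexE hq; have gsym := turk_alex_sym hq.
rewrite -/g in gs gsym.
have gpos i : (i < size g)%N -> 0 < g`_i by apply: lc_poly_gt0; rewrite ?g0.
have G := burau_alexander_doteq q; rewrite -/g in G.
split; first by exists (g \Po - 'X); apply: doteq_sym.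
move=> f /doteq_trans /(_ G) [b [m /tofrac_unitM_poly]].
rewrite coef_comp_polyNX g0 expr0 mulr1 => /(_ isT) [n fE].
have NX2 : size (- 'X : {poly int}) = 2 by rewrite size_polyN size_polyX.
have sG : size (g \Po - 'X) = size g by rewrite size_comp_poly2.
have fcoef k : `|f`_k| = if (k < n)%N then 0 else g`_(k - n).
  have -> : `|f`_k| = `|('X^n * (g \Po - 'X))`_k|.
    rewrite fE -mulrA -signr_odd; case: (odd b); rewrite ?mul1r //.
    by rewrite expr1 mulN1r coefN normrN.
  rewrite coefXnM; case: ifP => _; first by rewrite normr0.
  by rewrite coef_comp_polyNX normrM normrX normrN1 expr1n mul1r ger0_norm ?glc.1.
split.
  apply: (@trapezoidal_shift _ g (3 * q.-1) n) => //.
    rewrite size_map fE -mulrA -signr_odd.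
    have sn : size ('X^n * (g \Po - 'X)) = (n + size g)%N.
      by rewrite mulrC size_mulXn -?size_poly_gt0 sG // gs.
    by case: (odd b); rewrite ?mul1r // expr1 mulN1r size_polyN.
  by move=> k; rewrite nth_norm fcoef.
exists g; split.
- apply: doteq_sym; exists (b (+) odd n), n%:Z.
  have -> : f \Po - 'X = (-1) ^+ (b (+) odd n) * 'X^n * g.
    by rewrite fE comp_polyNX_shift.
  by rewrite !tofracM !tofracXn tofracN tofrac1.
- by rewrite -size_poly_gt0 gs.
- by rewrite /reciprocal gs.
- exact: gpos.
- have [gge gl] := glc; split=> [k _|k k1 _]; first exact: gge.
  by rewrite expr2; case: k k1 => // k _; rewrite gl.
Qed.
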